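(* Let $G$ be a graph with at least two vertices. Then $G$ is $k$-adjacency dimensional if and only if $k=\mathcal{C}(G)$. Moreover, $\mathcal{C}(G)$ can be computed in $O(|V(G)|^3)$ time.
   Context: All graphs are finite and simple (not necessarily connected). For a graph $G=(V,E)$, $d_G(x,y)$ is the length of a shortest $x$–$y$ path ($d_G(x,y)=\infty$ if $x,y$ lie in different components), and $d_{G,2}(x,y)=\min\{d_G(x,y),2\}$. For distinct $x,y\in V$, $\mathcal{C}_G(x,y)=\{z\in V:\ d_{G,2}(x,z)\neq d_{G,2}(y,z)\}$, and $\mathcal{C}(G)=\min_{x\neq y}|\mathcal{C}_G(x,y)|$. A set $S\subseteq V$ is a $k$-adjacency generator for $G$ if $|S\cap\mathcal{C}_G(x,y)|\ge k$ for every pair of distinct $x,y\in V$. A $k$-adjacency generator of minimum cardinality is a $k$-adjacency basis, and its cardinality is the $k$-adjacency dimension $\operatorname{adim}_k(G)$. $G$ is called $k$-adjacency dimensional if $k$ is the largest integer such that a $k$-adjacency basis (equivalently, a $k$-adjacency generator) of $G$ exists. *)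

(* Defs.v *)
From mathcomp Require Import all_boot.
Set Implicit Arguments.
Unset Strict Implicit.
Unset Printing Implicit Defensive.

Record sgraph := SGraph {
  vertex :> finType;
  edge : rel vertex;
  edge_sym : symmetric edge;
  edge_irrefl : irreflexive edge }.

Section Adjacency.
Variable G : sgraph.
Implicit Types (x y z : G) (S : {set G}) (k n : nat).

Definition has_path n x y : bool :=
  [exists p : n.-tuple G,
     [&& path (@edge G) x p, last x p == y & uniq (x :: p)]].

Lemma connect_has_path x y :
  connect (@edge G) x y -> exists n, has_path n x y.
Proof.
case/connectP=> p e_p ->; case: (shortenP e_p) => q e_q uq _.
exists (size q); apply/existsP; exists (in_tuple q).
by rewrite e_q eqxx uq.
Qed.

(* None stands for an infinite distance. *)
Definition dist x y : option nat :=
  if @idP (connect (@edge G) x y) is ReflectT xy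
  then Some (ex_minn (connect_has_path xy)) else None.

Definition dist2 x y : nat := if dist x y is Some d then minn d 2 else 2.

Definition distinguishing x y : {set G} := [set z | dist2 x z != dist2 y z].

(* The default value #|G| bounds every term, so it does not affect the minimum
   as soon as there is a pair of distinct vertices. *)
Definition min_distinguishing : nat :=
  \big[minn/#|G|]_(xy : G * G | xy.1 != xy.2) #|distinguishing xy.1 xy.2|.

Definition adjacency_generator k S : Prop :=
  forall x y, x != y -> k <= #|S :&: distinguishing x y|.

Definition adjacency_basis k S : Prop :=
  adjacency_generator k S /\
  forall S', adjacency_generator k S' -> #|S| <= #|S'|.

Definition adjacency_dimensional k : Prop :=
  (exists S, adjacency_basis k S) /\
  forall k', (exists S, adjacency_basis k' S) -> k' <= k.

End Adjacency.

(* Running time is measured by the number of instructions executed by a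
   random-access machine.  Its only arithmetic is successor and predecessor:
   from an n-vertex input, all numbers occurring in t steps are at most
   n + t plus a constant of the program, so that unit cost per instruction
   cannot hide any work on long integers. *)
Inductive instr :=
  | Const (d k : nat)
  | Move (d a : nat)
  | Succ (d : nat)
  | Pred (d : nat)
  | Read (d a : nat)
  | Write (a b : nat)
  | Jump (l : nat)
  | JumpZ (a l : nat).

Definition program := seq instr.

Record config := Config { pc : nat; reg : nat -> nat; mem : nat -> nat }.

Definition update (f : nat -> nat) (a v : nat) : nat -> nat :=
  fun b => if b == a then v else f b.

Definition exec (i : instr) (s : config) : config :=
  let: Config p r m := s in
  match i with
  | Const d k => Config p.+1 (update r d k) m
  | Move d a => Config p.+1 (update r d (r a)) m
  | Succ d => Config p.+1 (update r d (r d).+1) m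
  | Pred d => Config p.+1 (update r d (r d).-1) m
  | Read d a => Config p.+1 (update r d (m (r a))) m
  | Write a b => Config p.+1 r (update m (r a) (r b))
  | Jump l => Config l r m
  | JumpZ a l => Config (if r a == 0 then l else p.+1) r m
  end.

Definition halted (P : program) (s : config) : bool := size P <= pc s.

Definition step (P : program) (s : config) : config :=
  if onth P (pc s) is Some i then exec i s else s.

(* Halted configurations are fixed by step, so this says that P halts after at
   most t instructions; the output is read in register 0. *)
Definition outputs_within (P : program) (s : config) (t v : nat) : Prop :=
  let s' := iter t (step P) s in halted P s' /\ reg s' 0 = v.

(* The number of vertices in register 0, and in memory the adjacency matrix,
   row by row, for the vertex ordering vs. *)
Definition matrix_input (G : sgraph) (vs : seq G) : config :=
  Config 0 (update (fun=> 0) 0 (size vs))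
    (nth 0 [seq nat_of_bool (edge x y) | x <- vs, y <- vs]).

(* Main.v *)
Require Import Defs.
From mathcomp Require Import all_boot.
From mathcomp Require Import zify.

(** For distinct [x] and [y], the whole vertex set is a [k]-adjacency generator
    as soon as any set is, so generators exist exactly for [k <= C(G)].

    For the running time: if [x <> y], the rows of [x] and [y] in the adjacency
    matrix differ exactly at the distinguishing vertices, except that [x] and
    [y] themselves, which always distinguish the pair, are missed when they are
    not adjacent.  Hence [|C_G(x, y)|] is the Hamming distance of two rows, plus
    2 for non-adjacent pairs, and costs linear time per pair.  Rows are scanned
    in storage order, so addresses are obtained by successors only, and the
    minimum [min b c] is updated by testing whether the truncated difference
    [b - c], computed by one predecessor per unit of [c], vanishes. *)

Set Implicit Arguments.
Unset Strict Implicit.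
Unset Printing Implicit Defensive.

(** * Minima characterised by their lower bounds *)

Lemma leq_bigmin (I : Type) (r : seq I) (P : pred I) (F : I -> nat) n v :
  (v <= \big[minn/n]_(i <- r | P i) F i) =
  (v <= n) && all (fun i => P i ==> (v <= F i)) r.
Proof.
elim: r => [|i r IH]; first by rewrite big_nil andbT.
rewrite big_cons /=; case: (P i) => //=.
by rewrite leq_min IH andbCA.
Qed.

Lemma leq_foldl_minn v b s : (v <= foldl minn b s) = (v <= b) && all (leq v) s.
Proof.
by elim: s b => [|c s IH] b /=; rewrite ?andbT // IH leq_min -andbA.
Qed.

(** Compares two minima over differently enumerated pairs through their lower bounds. *)
Lemma eq_from_leq m n : (forall v, (v <= m) = (v <= n)) -> m = n.
Proof. by move=> H; apply/eqP; rewrite eqn_leq -H leqnn H leqnn. Qed.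

(** * Truncated distances and the adjacency dimension *)

Section Dimension.
Variable G : sgraph.
Implicit Types (x y z : G) (S : {set G}).

Lemma has_path0 x y : has_path 0 x y = (x == y).
Proof.
apply/existsP/idP => [[p]|/eqP <-]; last by exists [tuple]; rewrite /= eqxx.
by rewrite (tuple0 p) /= andbT.
Qed.

Lemma has_path1 x y : x != y -> has_path 1 x y = edge x y.
Proof.
move=> xy; apply/existsP/idP => [[p]|exy].
  case: (tupleP p) => z q; rewrite (tuple0 q) /= andbT.
  by case/and3P => exz /eqP <-.
by exists [tuple y]; rewrite /= exy eqxx inE xy.
Qed.

Lemma dist2E x y : dist2 x y = if x == y then 0 else if edge x y then 1 else 2.
Proof.
rewrite /dist2 /dist; case: {-}_ / idP => [xy|nxy]; last first.
  case: eqP => [exy|_]; first by case: nxy; rewrite exy connect0.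
  by case: ifP => // exy; case: nxy; apply: connect1.
case: ex_minnP => d dP dmin.
case: eqVneq => [exy|nxy].
  have /dmin : has_path 0 x y by rewrite has_path0 exy.
  by rewrite leqn0 => /eqP ->.
case: d dP dmin => [|d] dP dmin; first by rewrite has_path0 (negPf nxy) in dP.
case: ifP => exy.
  have /dmin : has_path 1 x y by rewrite has_path1.
  by rewrite ltnS leqn0 => /eqP ->.
by case: d dP dmin => [|d _ _]; [rewrite has_path1 ?exy | lia].
Qed.

Lemma card_distinguishing x y : x != y ->
  #|distinguishing x y| =
  (~~ edge x y) * 2 + \sum_(z : G) (edge x z != edge y z).
Proof.
move=> xy.
have sum1 u : \sum_(z : G) (z == u) = 1.
  by rewrite (bigD1 u) //= eqxx big1 // => z /negPf ->.
(* The 2 is spread over [z] as the indicators of [x] and [y], leaving an identity to check at each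
   [z]. *)
have -> : ~~ edge x y * 2 =
    \sum_(z : G) (~~ edge x y * (z == x) + ~~ edge x y * (z == y)).
  by rewrite big_split -!big_distrr /= !sum1 -mulnDr.
rewrite -big_split /=.
rewrite -sum1_card big_mkcond /=; apply: eq_bigr => z _.
rewrite inE !dist2E ![z == _]eq_sym.
case: (eqVneq x z) => [<-|xz].
  by rewrite [y == x]eq_sym (negPf xy) [edge y x]edge_sym edge_irrefl; case: edge.
case: (eqVneq y z) => [<-|yz]; first by rewrite edge_irrefl; case: edge.
by case: (edge x z); case: (edge y z); rewrite ?muln0.
Qed.

Lemma distinguishingC x y : distinguishing x y = distinguishing y x.
Proof. by apply/setP => z; rewrite !inE eq_sym. Qed.

Lemma leq_min_distinguishing v :
  reflect (v <= #|G| /\ forall x y, x != y -> v <= #|distinguishing x y|)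
          (v <= min_distinguishing G).
Proof.
rewrite leq_bigmin; apply: (iffP andP) => -[vG vD]; split => //.
  by move=> x y xy; apply: (implyP (allP vD (x, y) (mem_index_enum _))).
by apply/allP => -[x y] _; apply/implyP => /vD.
Qed.

Lemma adjacency_generator_leq k S : 1 < #|G| ->
  adjacency_generator k S -> k <= min_distinguishing G.
Proof.
(* A pair of distinct vertices bounds [k] by [#|G|], the default value of the minimum. *)
case/card_gt1P => a [b [_ _ ab]] gS; apply/leq_min_distinguishing; split.
  exact: leq_trans (gS _ _ ab) (max_card _).
by move=> x y /gS kS; apply: leq_trans kS (subset_leq_card (subsetIr _ _)).
Qed.

Lemma adjacency_basis_exists k :
  k <= min_distinguishing G -> exists S, adjacency_basis k S.
Proof.
case/leq_min_distinguishing => _ kD.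
pose gen S := [forall x, forall y, (x != y) ==> (k <= #|S :&: distinguishing x y|)].
have genP S : reflect (adjacency_generator k S) (gen S).
  apply: (iffP 'forall_forallP) => gS x y; last by apply/implyP/gS.
  by move=> xy; apply: (implyP (gS x y)).
have genT : gen setT by apply/genP => x y xy; rewrite setTI kD.
case: (arg_minnP (fun S => #|S|) genT) => S /genP gS minS.
by exists S; split => // S' /genP /minS.
Qed.

Lemma adjacency_dimensionalE k : 1 < #|G| ->
  adjacency_dimensional G k <-> k = min_distinguishing G.
Proof.
move=> G1; split=> [[[S [gS _]] maxk]|->].
  apply/eqP; rewrite eqn_leq (adjacency_generator_leq G1 gS).
  exact/maxk/adjacency_basis_exists.
split=> [|k' [S [gS _]]]; first exact: adjacency_basis_exists.
exact: adjacency_generator_leq gS.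
Qed.

End Dimension.

(** * Machine runs on lists of registers *)

(* Registers held in a list, so that executing concrete code is a matter of
   computation. *)
Definition lconfig := (nat * seq nat * (nat -> nat))%type.

Definition lexec (i : instr) (s : lconfig) : lconfig :=
  let: (p, r, m) := s in
  match i with
  | Const d k => (p.+1, set_nth 0 r d k, m)
  | Move d a => (p.+1, set_nth 0 r d (nth 0 r a), m)
  | Succ d => (p.+1, set_nth 0 r d (nth 0 r d).+1, m)
  | Pred d => (p.+1, set_nth 0 r d (nth 0 r d).-1, m)
  | Read d a => (p.+1, set_nth 0 r d (m (nth 0 r a)), m)
  | Write a b => (p.+1, r, update m (nth 0 r a) (nth 0 r b))
  | Jump l => (l, r, m)
  | JumpZ a l => (if nth 0 r a == 0 then l else p.+1, r, m)
  end.

Definition lstep (P : program) (s : lconfig) : lconfig :=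
  if onth P s.1.1 is Some i then lexec i s else s.

Definition represents (l : lconfig) (s : config) : Prop :=
  [/\ pc s = l.1.1, reg s =1 nth 0 l.1.2 & Defs.mem s = l.2].

Lemma represents_step P l s :
  represents l s -> represents (lstep P l) (step P s).
Proof.
case: l s => [[p r] m] [p' r' m'] [/= -> rE ->].
rewrite /step /lstep /=; case: onth => [i|] //.
case: i => [d k|d a|d|d|d a|a b|j|a j] /=; split=> //=; try move=> b;
  by rewrite ?nth_set_nth /= /update ?rE.
Qed.

Lemma represents_iter P t l s :
  represents l s -> represents (iter t (lstep P) l) (iter t (step P) s).
Proof. by move=> ls; elim: t => //= t; apply: represents_step. Qed.

Lemma outputs_within_halted P s t u v :
  u <= t -> outputs_within P s u v -> outputs_within P s t v.
Proof.
move=> ut [hs rs]; rewrite /outputs_within.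
suff -> : iter t (step P) s = iter u (step P) s by [].
rewrite -(subnK ut) iterD; elim: (t - u) => //= w ->.
by rewrite /step onth_default.
Qed.

(** An upper bound on the time lets branches of different lengths share one statement. *)
Definition reaches P t s s' := exists2 u, u <= t & iter u (lstep P) s = s'.

Lemma reaches_trans P t u s s' s'' :
  reaches P t s s' -> reaches P u s' s'' -> reaches P (t + u) s s''.
Proof.
move=> [t' tt' <-] [u' uu' <-]; exists (u' + t'); last by rewrite iterD.
by rewrite addnC leq_add.
Qed.

Lemma reaches_le P t u s s' : t <= u -> reaches P t s s' -> reaches P u s s'.
Proof. by move=> tu [v vt vE]; exists v; rewrite ?(leq_trans vt). Qed.

(** * The program and its loops *)

(* Register 0 holds the minimum over the pairs treated so far, 1 the number n
   of columns, 2 the number of rows not yet compared with all the preceding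
   ones, 3 the current row y, 4 the address of that row, 5 the number of rows
   x < y still to be compared with it, 6 an address running through the rows
   x, 7 the address of the entry (y, x), 8 an address running through row y, 9
   the number of columns still to be compared, 10 the cardinality being
   computed, and 11 the truncated difference of registers 0 and 10. *)
Definition min_distinguishing_program : program := [::
  (*  0 *) Move 1 0; Move 2 0; Move 4 0;
  (*  3 *) Pred 2; JumpZ 2 41; Succ 3; Move 5 3; Const 6 0; Move 7 4;
  (*  9 *) JumpZ 5 39; Pred 5; Move 8 4; Move 9 1; Const 10 0; Move 11 0;
  (* 15 *) Read 12 7; Succ 7; JumpZ 12 19; Jump 23;
  (* 19 *) Succ 10; Succ 10; Pred 11; Pred 11;
  (* 23 *) JumpZ 9 36; Pred 9; Read 12 6; Read 13 8; Succ 6; Succ 8;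
  (* 29 *) JumpZ 12 32; JumpZ 13 33; Jump 23; JumpZ 13 23;
  (* 33 *) Succ 10; Pred 11; Jump 23;
  (* 36 *) JumpZ 11 9; Move 0 10; Jump 9;
  (* 39 *) Move 4 8; Jump 3].

(** Entries enter only through zero tests, the only test the machine has. *)
Definition row_diff (m : nat -> nat) (a b k : nat) : nat :=
  \sum_(0 <= z < k) ((m (a + z) == 0) != (m (b + z) == 0)).

Lemma row_diffS m a b k :
  row_diff m a b k.+1 =
  ((m a == 0) != (m b == 0)) + row_diff m a.+1 b.+1 k.
Proof.
rewrite /row_diff big_nat_recl // !addn0; congr (_ + _).
by apply: eq_bigr => z _; rewrite !addSnnS.
Qed.

Definition pair_count (m : nat -> nat) n y x : nat :=
  (m (y * n + x) == 0) * 2 + row_diff m (x * n) (y * n) n.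

Section Execution.
Variables (m : nat -> nat) (n : nat).
Local Notation runs := (reaches min_distinguishing_program).

Lemma column_loop best i y py j q k a b c u v : exists u' v',
  runs (11 * k + 1)
    (23, [:: best; n; i; y; py; j; a; q; b; k; c; best - c; u; v], m)
    (let c' := c + row_diff m a b k in
     (36, [:: best; n; i; y; py; j; a + k; q; b + k; 0; c'; best - c'; u'; v'], m)).
Proof.
elim: k a b c u v => [|k IH] a b c u v.
  by exists u, v; exists 1; rewrite // /row_diff big_nil !addn0.
set c1 := c + ((m a == 0) != (m b == 0)).
have [u' [v' R]] := IH a.+1 b.+1 c1 (m a) (m b).
exists u', v'; rewrite row_diffS addnA -/c1 -(addSnnS a) -(addSnnS b) mulnS -addnA.
apply: reaches_trans R; rewrite /c1 {c1 IH}.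
(* The 11 steps per column: six of straight code, then at most five to decide whether the entries
   differ. *)
apply: (reaches_trans (t := 6) (u := 5) (s' := (29,
  [:: best; n; i; y; py; j; a.+1; q; b.+1; k; c; best - c; m a; m b], m))).
  by exists 6.
case: (m a) => [|ma]; case: (m b) => [|mb] /=; rewrite ?addn0 ?addn1 ?subnS.
- by exists 2.
- by exists 5.
- by exists 5.
- by exists 3.
Qed.

Lemma row_step best i y j x b k c d u v : exists k' c' d' u' v',
  runs (11 * n + 17)
    (9, [:: best; n; i; y; y * n; j.+1; x * n; y * n + x; b; k; c; d; u; v], m)
    (9, [:: minn best (pair_count m n y x); n; i; y; y * n; j; x.+1 * n;
            y * n + x.+1; y * n + n; k'; c'; d'; u'; v'], m).
Proof.
set e := (m (y * n + x) == 0) * 2.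
have [u' [v' R]] := column_loop best i y (y * n) j (y * n + x.+1) n (x * n)
  (y * n) e (m (y * n + x)) v.
set cnt := pair_count m n y x.
exists 0, cnt, (best - cnt), u', v'.
(* Eight steps of setup and at most five for the adjacency test precede the column loop; at most
   three update the minimum. *)
rewrite (_ : 11 * n + 17 = 13 + (11 * n + 1 + 3)); last by lia.
apply: reaches_trans (reaches_trans R _).
  apply: (reaches_trans (t := 8) (u := 5) (s' := (17, [:: best; n; i; y; y * n; j;
    x * n; y * n + x.+1; y * n; n; 0; best; m (y * n + x); v], m))).
    by exists 8; rewrite // addnS.
  rewrite /e; case: (m (y * n + x)) => [|w] /=.
    by exists 5; rewrite // mul1n subn2.
  by exists 2; rewrite // mul0n subn0.
rewrite /= -/(pair_count m n y x) -/cnt mulSnr.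
case E: (best - cnt) => [|w].
  by exists 1; rewrite //= (minn_idPl _) // -subn_eq0 E.
by exists 3; rewrite //= (minn_idPr _) // ltnW // -subn_gt0 E.
Qed.

(** At least one row is compared, so register 8 has reached the end of row [y] and supplies the
    address of the next row. *)
Lemma row_loop best i y j x b k c d u v : exists k' c' d' u' v',
  runs ((11 * n + 17) * j.+1 + 1)
    (9, [:: best; n; i; y; y * n; j.+1; x * n; y * n + x; b; k; c; d; u; v], m)
    (39, [:: foldl minn best [seq pair_count m n y x' | x' <- iota x j.+1];
             n; i; y; y * n; 0; (x + j.+1) * n; y * n + (x + j.+1);
             y.+1 * n; k'; c'; d'; u'; v'], m).
Proof.
elim: j best x b k c d u v => [|j IH] best x b k c d u v.
  have [k1 [c1 [d1 [u1 [v1 R]]]]] := row_step best i y 0 x b k c d u v.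
  exists k1, c1, d1, u1, v1; rewrite muln1; apply: reaches_trans R _.
  by exists 1; rewrite //= addn1 [y.+1 * n]mulSnr.
have [k1 [c1 [d1 [u1 [v1 R1]]]]] := row_step best i y j.+1 x b k c d u v.
have [k' [c' [d' [u' [v' R]]]]] :=
  IH (minn best (pair_count m n y x)) x.+1 (y * n + n) k1 c1 d1 u1 v1.
exists k', c', d', u', v'; rewrite mulnS -addnA -(addSnnS x).
exact: reaches_trans R1 R.
Qed.

Definition all_pairs_min :=
  foldl (fun b y => foldl minn b [seq pair_count m n y x | x <- iota 0 y]).

Lemma outer_loop best i y j a q b k c d u v : i + y < n -> exists r,
  runs (((11 * n + 17) * n + 9) * i + 2)
    (3, [:: best; n; i.+1; y; y.+1 * n; j; a; q; b; k; c; d; u; v], m)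
    (41, all_pairs_min best (iota y.+1 i) :: r, m).
Proof.
elim: i best y j a q b k c d u v => [|i IH] best y j a q b k c d u v yn.
  by eexists; exists 2; [rewrite muln0 | reflexivity].
have [k1 [c1 [d1 [u1 [v1 R1]]]]] := row_loop best i.+1 y.+1 y 0 b k c d u v.
have {IH} [|r R] := IH (foldl minn best [seq pair_count m n y.+1 x | x <- iota 0 y.+1])
  y.+1 0 ((0 + y.+1) * n) (y.+1 * n + (0 + y.+1)) (y.+2 * n) k1 c1 d1 u1 v1.
  by lia.
exists r.
(* The 9 is six steps of setup, one to leave the row loop and two to return. *)
apply: (@reaches_le _ (6 + ((11 * n + 17) * y.+1 + 1 + (2 +
  (((11 * n + 17) * n + 9) * i + 2))))).
  have : (11 * n + 17) * y.+1 <= (11 * n + 17) * n by rewrite leq_mul2l; lia.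
  by rewrite mulnS; lia.
apply: (reaches_trans (s' := (9, [:: best; n; i.+1; y.+1; y.+1 * n; y.+1; 0 * n;
  y.+1 * n + 0; b; k; c; d; u; v], m))).
  by exists 6; rewrite // mul0n addn0.
apply: reaches_trans R1 _; apply: reaches_trans R.
by exists 2.
Qed.

Lemma program_reaches : 0 < n -> exists r,
  runs (42 * n ^ 3) (0, n :: nseq 13 0, m)
    (41, all_pairs_min n (iota 1 n.-1) :: r, m).
Proof.
move=> n0; have [|r R] := @outer_loop n n.-1 0 0 0 0 0 0 0 0 0 0; first by lia.
exists r.
(* Raising every power of [n] to [n ^ 3] gives 42 = 11 + 17 + 9 + 5, where 5 counts the three
   initial moves and the two final steps. *)
apply: (@reaches_le _ (3 + (((11 * n + 17) * n + 9) * n.-1 + 2))).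
  by rewrite !expnS expn0; nia.
apply: reaches_trans R; exists 3 => //.
by rewrite prednK // mul1n.
Qed.

End Execution.

(** * Correctness of the computed minimum *)

Lemma leq_all_pairs_min m n b s v :
  (v <= all_pairs_min m n b s) =
  (v <= b) && all (fun y => all (fun x => v <= pair_count m n y x) (iota 0 y)) s.
Proof.
elim: s b => [|y s IH] b /=; first by rewrite andbT.
by rewrite IH leq_foldl_minn all_map -andbA.
Qed.

Lemma nth_allpairs (S T R : Type) (f : S -> T -> R) x0 y0 z0 s t i j :
  i < size s -> j < size t ->
  nth z0 [seq f x y | x <- s, y <- t] (i * size t + j) =
  f (nth x0 s i) (nth y0 t j).
Proof.
elim: s i => [|x s IH] [|i] //= si tj.
  by rewrite nth_cat size_map tj (nth_map y0).
by rewrite nth_cat size_map mulSn -addnA ltnNge leq_addr /= addKn IH.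
Qed.

Section Matrix.
Variables (G : sgraph) (vs : seq G) (v0 : G).
Hypothesis vsE : perm_eq vs (enum G).
Local Notation m := (Defs.mem (matrix_input vs)).

Let size_vs : size vs = #|G|.
Proof. by rewrite (perm_size vsE) cardE. Qed.

Let uniq_vs : uniq vs.
Proof. by rewrite (perm_uniq vsE) enum_uniq. Qed.

Lemma mem_matrix_input i j : i < #|G| -> j < #|G| ->
  (m (i * #|G| + j) == 0) = ~~ edge (nth v0 vs i) (nth v0 vs j).
Proof.
rewrite -size_vs => iG jG.
by rewrite /= (nth_allpairs _ v0 v0) //; case: edge.
Qed.

Lemma pair_countE x y : x < #|G| -> y < #|G| -> x != y ->
  pair_count m #|G| y x = #|distinguishing (nth v0 vs y) (nth v0 vs x)|.
Proof.
move=> xG yG xy; rewrite card_distinguishing; last first.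
  by rewrite nth_uniq ?size_vs // eq_sym.
rewrite /pair_count mem_matrix_input //; congr (_ + _).
rewrite -big_enum -(perm_big _ vsE) /= (big_nth v0) size_vs.
rewrite /row_diff !big_mkord; apply: eq_bigr => z _.
by rewrite !mem_matrix_input //; do 2 case: edge.
Qed.

(** Both minima start from [#|G|], and by symmetry the index pairs [x < y] account for all pairs of
    distinct vertices, so the lower bounds agree. *)
Lemma all_pairs_minE :
  all_pairs_min m #|G| #|G| (iota 1 #|G|.-1) = min_distinguishing G.
Proof.
apply: eq_from_leq => v; rewrite leq_all_pairs_min.
apply/andP/leq_min_distinguishing => -[vG H]; split=> //; last first.
  apply/allP => y; rewrite mem_iota => yP; apply/allP => x; rewrite mem_iota => xP.
  by rewrite pair_countE; [apply: H; rewrite nth_uniq ?size_vs | | |]; lia.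
have key i j : i < j -> j < #|G| ->
    v <= #|distinguishing (nth v0 vs j) (nth v0 vs i)|.
  move=> ij jG; rewrite -pair_countE; [|by lia..].
  have /(allP H)/allP : j \in iota 1 #|G|.-1 by rewrite mem_iota; lia.
  by apply; rewrite mem_iota.
move=> x y; have vsP z : z \in vs by rewrite (perm_mem vsE) mem_enum.
rewrite -(nth_index v0 (vsP x)) -(nth_index v0 (vsP y)).
have := vsP x; have := vsP y; rewrite -!index_mem size_vs => yG xG.
case: (ltngtP (index x vs) (index y vs)) => [xy|yx|->] xy'.
- by rewrite distinguishingC key.
- exact: key.
- by rewrite eqxx in xy'.
Qed.

End Matrix.

Theorem theorem1 :
  (forall (G : sgraph) (k : nat), 1 < #|G| ->
     adjacency_dimensional G k <-> k = min_distinguishing G) /\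
  (exists (P : program) (c : nat),
     forall (G : sgraph) (vs : seq G), 1 < #|G| -> perm_eq vs (enum G) ->
       outputs_within P (matrix_input vs) (c * #|G| ^ 3) (min_distinguishing G)).
Proof.
split; first exact: adjacency_dimensionalE.
exists min_distinguishing_program, 42 => G vs G1 vsE.
have [v0 _] := card_gt0P (ltnW G1).
have [r [u u_le uE]] := program_reaches (Defs.mem (matrix_input vs)) (ltnW G1).
have init : represents (0, #|G| :: nseq 13 0, Defs.mem (matrix_input vs))
                       (matrix_input vs).
  split=> //= b; rewrite /update (perm_size vsE) -cardE.
  (* Registers past the end of the list read as the default 0, as they do initially. *)
  by case: b => // b; rewrite /= (nth_nseq 0 13 0 b) if_same.
have := represents_iter min_distinguishing_program u init.
rewrite {}uE => -[pcE regE _].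
apply: (outputs_within_halted u_le); split; first by rewrite /halted pcE.
by rewrite regE /= all_pairs_minE.
Qed.
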